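(* Let $0\le c<2$. For all $x\in\mathbb{R}$ the mapping $y\mapsto\Xi_\infty^{(c)}(x,y)$ is strictly monotonic.
   Context: $\mu(x)=1$ for $x<0$, $\mu(x)=-1$ for $x>0$. Equations are understood in the sense of distributions. For $c\in[0,2)$, $\theta^{(c)}:\mathbb{R}\to(0,1)$ is the unique solution of $\theta''+c\theta'+\mu(x)\theta-\theta^3=0$ on $\mathbb{R}$ with $\theta(-\infty)=1$, $\theta(+\infty)=0$. $\Xi_\infty^{(c)}:\mathbb{R}^2\to\mathbb{R}$ denotes the $\mathcal{H}_\infty$-pattern: the ($\mathscr{C}^{(1,\alpha)}$ for all $\alpha\in[0,1)$) solution of $\Delta u+c\partial_xu+\mu(x)u-u^3=0$ in $\mathbb{R}^2$ which is odd in $y$, satisfies $\partial_y\Xi_\infty^{(c)}\le0$, and has the limits $\lim_{x\to-\infty}\Xi_\infty^{(c)}(x,y)=-\tanh(y/\sqrt2)$, $\lim_{y\to\pm\infty}\Xi_\infty^{(c)}(x,y)=\mp\theta^{(c)}(x)$, $\lim_{x\to+\infty}\Xi_\infty^{(c)}(x,y)=0$. *)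

(* Defs.v *)
From HB Require Import structures.
From mathcomp Require Import all_boot all_order all_algebra.
From mathcomp Require Import all_classical all_reals all_analysis.
Set Implicit Arguments.
Unset Strict Implicit.
Unset Printing Implicit Defensive.
Import Order.TTheory GRing.Theory Num.Theory.
Import numFieldNormedType.Exports.
Local Open Scope classical_set_scope.
Local Open Scope ring_scope.

(* The value at x = 0 is immaterial: mu only occurs under Lebesgue integrals. *)
Definition mu {R : realType} (x : R) : R := if x < 0 then 1 else -1.

Definition tanh {R : realType} (x : R) : R :=
  (expR x - expR (- x)) / (expR x + expR (- x)).

Definition pdx {R : realType} (f : R * R -> R) : R * R -> R :=
  fun p => 'D_(1, 0) f p.
Definition pdy {R : realType} (f : R * R -> R) : R * R -> R :=
  fun p => 'D_(0, 1) f p.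
Definition laplacian {R : realType} (f : R * R -> R) : R * R -> R :=
  fun p => pdx (pdx f) p + pdy (pdy f) p.

Fixpoint Ck {R : realType} (k : nat) (f : R * R -> R) : Prop :=
  if k is k'.+1 then
    [/\ continuous f,
        forall p, derivable f p (1, 0) /\ derivable f p (0, 1),
        Ck k' (pdx f) & Ck k' (pdy f)]
  else continuous f.

Definition test_function2 {R : realType} (phi : R * R -> R) : Prop :=
  (forall k, Ck k phi) /\ compact (closure [set p | phi p != 0]).

Definition test_function1 {R : realType} (phi : R -> R) : Prop :=
  (forall k x, derivable (derive1n k phi) x 1) /\
  compact (closure [set x | phi x != 0]).

(* Hoelder continuity on compact sets; the norm of R * R is the sup norm. *)
Definition locally_hoelder {R : realType} (alpha : R) (f : R * R -> R) : Prop :=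
  forall K : set (R * R), compact K ->
    exists C : R, forall p q, K p -> K q ->
      `|f p - f q| <= C * `|p - q| `^ alpha.

Definition C1alpha {R : realType} (alpha : R) (f : R * R -> R) : Prop :=
  [/\ Ck 1 f, locally_hoelder alpha (pdx f) & locally_hoelder alpha (pdy f)].

(* theta'' + c theta' + mu theta - theta^3 = 0 in D'(R) *)
Definition distributional_solution1 {R : realType} (c : R) (theta : R -> R) :
    Prop :=
  forall phi, test_function1 phi ->
    \int[@lebesgue_measure R]_x
      (theta x * (derive1n 2 phi x - c * derive1 phi x)
       + (mu x * theta x - theta x ^+ 3) * phi x) = 0.

(* Delta u + c d_x u + mu(x) u - u^3 = 0 in D'(R^2) *)
Definition distributional_solution2 {R : realType} (c : R) (u : R * R -> R) :
    Prop :=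
  forall phi, test_function2 phi ->
    \int[(@lebesgue_measure R \x @lebesgue_measure R)%E]_p
      (u p * (laplacian phi p - c * pdx phi p)
       + (mu p.1 * u p - u p ^+ 3) * phi p) = 0.

(* Continuity selects the pointwise representative of the distributional
   solution, without which theta is only determined almost everywhere. *)
Record is_theta {R : realType} (c : R) (theta : R -> R) : Prop := {
  theta_continuous : continuous theta ;
  theta_range : forall x, 0 < theta x < 1 ;
  theta_solution : distributional_solution1 c theta ;
  theta_ninfty : theta x @[x --> -oo] --> (1 : R) ;
  theta_pinfty : theta x @[x --> +oo] --> (0 : R) }.

Record is_Hinfty_pattern {R : realType} (c : R) (theta : R -> R)
    (Xi : R * R -> R) : Prop := {
  Xi_C1alpha : forall alpha : R, 0 <= alpha < 1 -> C1alpha alpha Xi ;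
  Xi_solution : distributional_solution2 c Xi ;
  Xi_odd : forall x y, Xi (x, - y) = - Xi (x, y) ;
  Xi_pdy_le0 : forall p, pdy Xi p <= 0 ;
  Xi_x_ninfty : forall y,
    Xi (x, y) @[x --> -oo] --> - tanh (y / Num.sqrt 2) ;
  Xi_y_pinfty : forall x, Xi (x, y) @[y --> +oo] --> - theta x ;
  Xi_y_ninfty : forall x, Xi (x, y) @[y --> -oo] --> theta x ;
  Xi_x_pinfty : forall y, Xi (x, y) @[x --> +oo] --> (0 : R) }.

(* Main.v *)
Require Import Defs.
From HB Require Import structures.
From mathcomp Require Import all_boot all_order all_algebra.
From mathcomp Require Import all_classical all_reals all_analysis.
From mathcomp Require Import measurable_realfun ring lra.
Import Order.TTheory GRing.Theory Num.Theory.
Import numFieldNormedType.Exports.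
Local Open Scope classical_set_scope.
Local Open Scope ring_scope.
Set Implicit Arguments.
Unset Strict Implicit.
Unset Printing Implicit Defensive.

(** Suppose that [u = Xi] takes the same value at [(x0, a)] and [(x0, b)], with
    [a < b]. By monotonicity [u (x0, .)] is constant on [[a, b]]. Let [g] be a
    bump function on [[a, b]] and put [V x = \int - u_y (x, y) g y dy], so that
    [V >= 0] and [V x0 = 0]. Testing the equation against [f x * g' y] and
    integrating by parts in [y] gives, since [g'' >= - K1 g] and [|u| <= 1], the
    one-dimensional inequality [V'' + c V' - K V <= 0] in the sense of
    distributions. A nonnegative continuous supersolution which vanishes at [x0]
    vanishes at every [x1 < x0]: test it against an explicit [f >= 0] which the
    adjoint operator maps to a combination of bumps, positive near [x1] and
    negative only near [x0]. Hence [u (x, a) = u (x, b)] for all [x < x0], and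
    letting [x] tend to [-oo] contradicts the strict monotonicity of [tanh]. *)

(** * Smooth functions on the line *)

Section Smooth.
Context {R : realType}.
Implicit Types (f g h : R -> R) (x : R).

(** The derivative is carried as a witness, so that closure under sums, products and affine
    substitutions is a plain induction on [n], with no formula for iterated derivatives. *)
Fixpoint times_derivable (n : nat) f : Prop :=
  if n is m.+1 then
    exists2 h, (forall x, is_derive x 1 f (h x)) & times_derivable m h
  else True.

Definition smooth f := forall n, times_derivable n f.

Lemma times_derivableW n f : times_derivable n.+1 f -> times_derivable n f.
Proof.
elim: n f => [//|n IH] f [h fh hn]; exists h => //; exact: IH.
Qed.

Lemma times_derivableD n f g : times_derivable n f -> times_derivable n g ->
  times_derivable n (fun x => f x + g x).
Proof.
elim: n f g => [//|n IH] f g [f' ff' fn] [g' gg' gn].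
exists (fun x => f' x + g' x); last exact: IH.
by move=> x; apply: (@is_deriveD _ _ _ f g).
Qed.

Lemma times_derivableM n f g : times_derivable n f -> times_derivable n g ->
  times_derivable n (fun x => f x * g x).
Proof.
elim: n f g => [//|n IH] f g fn gn.
have fn' := times_derivableW fn; have gn' := times_derivableW gn.
case: fn gn => f' ff' fn [g' gg' gn].
exists (fun x => f x * g' x + g x * f' x).
  by move=> x; apply: (@is_deriveM _ _ f g).
by apply: times_derivableD; apply: IH.
Qed.

Lemma times_derivable_cst n (k : R) : times_derivable n (fun=> k).
Proof.
elim: n k => [//|n IH] k; exists (fun=> 0) => // x; exact: is_derive_cst.
Qed.

Lemma is_derive_affine f (f' a b x : R) : is_derive (a * x + b) 1 f f' ->
  is_derive x 1 (fun y => f (a * y + b)) (a * f').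
Proof.
move=> ff'.
have H : is_derive x 1 (fun y : R => a * y + b) a.
  by apply: is_derive_eq; rewrite /= addr0 [LHS]mulr1.
by have := @is_derive1_comp _ f (fun y => a * y + b) x f' a ff' H; rewrite mulrC.
Qed.

Lemma times_derivable_affine n f (a b : R) : times_derivable n f ->
  times_derivable n (fun x => f (a * x + b)).
Proof.
elim: n f => [//|n IH] f [f' ff' fn].
exists (fun x => a * f' (a * x + b)).
  by move=> x; exact: is_derive_affine.
by apply: times_derivableM; [exact: times_derivable_cst | exact: IH].
Qed.

Lemma times_derivable_expR n : times_derivable n (@expR R).
Proof. elim: n => [//|n IH]; exists expR => // x; exact: is_derive_expR. Qed.

(** Derivatives are unique, so [h] is the witness contained in the (n+1)-fold derivability of
    [f]. *)
Lemma smooth_derive f h : (forall x, is_derive x 1 f (h x)) ->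
  smooth f -> smooth h.
Proof.
move=> fh sf n; have [h' fh' hn] := sf n.+1.
suff -> : h = h' by [].
apply/funext => x; rewrite -(@derive_val _ _ _ _ _ _ _ (fh x)).
by rewrite (@derive_val _ _ _ _ _ _ _ (fh' x)).
Qed.

Lemma smooth_primitive f h : (forall x, is_derive x 1 f (h x)) ->
  smooth h -> smooth f.
Proof. by move=> fh sh [//|n]; exists h. Qed.

Lemma is_derive_continuous f h : (forall x, is_derive x 1 f (h x)) ->
  continuous f.
Proof.
move=> fh x; apply: differentiable_continuous.
by apply/derivable1_diffP; case: (fh x).
Qed.

Lemma smooth_continuous f : smooth f -> continuous f.
Proof. by move=> /(_ 1%N)[h fh _]; exact: is_derive_continuous fh. Qed.

Lemma smooth_ex_derive f : smooth f ->
  exists2 h, (forall x, is_derive x 1 f (h x)) & smooth h.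
Proof.
move=> sf; have [h fh _] := sf 1%N; exists h => //; exact: smooth_derive fh sf.
Qed.

Lemma smooth_cst (k : R) : smooth (fun=> k).
Proof. by move=> n; exact: times_derivable_cst. Qed.

Lemma smoothM f g : smooth f -> smooth g -> smooth (fun x => f x * g x).
Proof. by move=> sf sg n; exact: times_derivableM. Qed.

Lemma smoothB f g : smooth f -> smooth g -> smooth (fun x => f x - g x).
Proof.
move=> sf sg n.
have -> : (fun x => f x - g x) = (fun x => f x + -1 * g x).
  by apply/funext => x; rewrite mulN1r.
apply: times_derivableD => //; apply: times_derivableM => //.
exact: times_derivable_cst.
Qed.

Lemma smooth_shift f (a : R) : smooth f -> smooth (fun x => f (x + a)).
Proof.
move=> sf n; have := @times_derivable_affine n f 1 a (sf n).
by congr times_derivable; apply/funext => x; rewrite mul1r.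
Qed.

Lemma smooth_expR (k : R) : smooth (fun x => expR (k * x)).
Proof.
move=> n; have := @times_derivable_affine n expR k 0 (times_derivable_expR n).
by congr times_derivable; apply/funext => x; rewrite addr0.
Qed.

Lemma is_derive_expR_scale (k x : R) :
  is_derive x 1 (fun x => expR (k * x)) (k * expR (k * x)).
Proof.
have := @is_derive_affine expR (expR (k * x + 0)) k 0 x (is_derive_expR _).
by rewrite addr0; congr is_derive; apply/funext => y; rewrite addr0.
Qed.

End Smooth.

(** * Bump functions *)

Section Flat.
Context {R : realType}.
Implicit Types (p : {poly R}) (t : R).

(** For [p = 1] this is the classical function exp(-1/t), extended by 0. The polynomial factor in
    1/t makes the family closed under differentiation. *)
Definition flat p t : R := if 0 < t then p.[t^-1] * expR (- t^-1) else 0.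

(** With s = 1/t, the i-th coefficient is handled by s^(i+1) <= (i+1)! exp(s), a single term of the
    exponential series. *)
Lemma flat_le p : exists C, forall t, `|flat p t| <= C * `|t|.
Proof.
exists (\sum_(i < size p) `|p`_i| * (i.+1)`!%:R) => t.
rewrite /flat; case: ltP => [t0|_]; last first.
  rewrite normr0 mulr_ge0//; apply: sumr_ge0 => i _; exact: mulr_ge0.
rewrite (gtr0_norm t0); set s := t^-1.
have s0 : 0 < s by rewrite invr_gt0.
have -> : t = s^-1 by rewrite invrK.
rewrite ler_pdivlMr// expRN normrM normfV (gtr0_norm (expR_gt0 _)) mulrAC.
rewrite ler_pdivrMr ?expR_gt0// horner_coef.
apply: le_trans (ler_wpM2r (ltW s0) (ler_norm_sum _ _ _)) _.
rewrite !mulr_suml; apply: ler_sum => i _.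
rewrite normrM -!mulrA ler_wpM2l// normrX (gtr0_norm s0) -exprSr.
rewrite mulrC -ler_pdivrMr ?ltr0n ?fact_gt0//.
by apply: le_trans (expR_ge1Dxn i (ltW s0)); rewrite lerDr.
Qed.

(** For t > 0 the chain rule yields the factor t^-2 (p - p')(1/t). For t < 0 the function is locally
    0, and at 0 the difference quotient tends to 0 by [flat_le]. *)
Lemma is_derive_flat p t :
  is_derive t 1 (flat p) (flat ('X^2 * (p - p^`())) t).
Proof.
have [t0|t0|->] := ltgtP t 0.
- have -> : flat ('X^2 * (p - p^`())) t = 0 by rewrite /flat ltNge (ltW t0).
  apply: (@near_eq_is_derive _ _ _ (cst (0 : R))) (is_derive_cst _ _ _).
  by near=> z; rewrite /flat ltNge ltW//; near: z; exact: lt_nbhsl.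
- have -> : flat ('X^2 * (p - p^`())) t =
    ('X^2 * (p - p^`())).[t^-1] * expR (- t^-1) by rewrite /flat t0.
  apply: (@near_eq_is_derive _ _ _ (fun z : R => p.[z^-1] * expR (- z^-1))).
  + by near=> z; rewrite /flat ifT//; near: z; exact: lt_nbhsr.
  + have dV : is_derive t 1 (fun z : R => z^-1) (- t ^- 2).
      apply: DeriveDef; first exact/derivableV/derivable_id/lt0r_neq0.
      by rewrite deriveV ?lt0r_neq0// derive_id [LHS]mulr1.
    have d1 := @is_derive1_comp _ _ _ _ _ _ (is_derive_poly p t^-1) dV.
    have d2 := @is_derive1_comp _ _ (fun z : R => - z^-1) _ _ _
      (is_derive_expR (- t^-1)) (is_deriveN dV).
    apply: (is_derive_eq (is_deriveM d1 d2)).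
    rewrite /= hornerM hornerXn hornerD hornerN /GRing.scale /= exprVn.
    by ring.
- have -> : flat ('X^2 * (p - p^`())) 0 = 0 by rewrite /flat ltxx.
  have f0 : flat p 0 = 0 by rewrite /flat ltxx.
  suff H : h^-1 *: (flat p (h *: (1 : R) + 0) - flat p 0)
      @[h --> (0 : R)^'] --> (0 : R).
    apply: DeriveDef; first by apply/cvg_ex; exists 0.
    by apply/cvg_lim => //; exact: H.
  (* Dividing by h multiplies the polynomial in 1/h by the indeterminate, so the difference quotient
     at 0 is itself a flat function and is O(h). *)
  have [C HC] := flat_le (p * 'X).
  have HC' h : `|h^-1 *: (flat p (h *: (1 : R) + 0) - flat p 0)| <= C * `|h|.
    apply: le_trans (HC h); rewrite f0 subr0 addr0 [h *: _]mulr1 /GRing.scale /=.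
    rewrite /flat; case: ifP => _; last by rewrite mulr0.
    by rewrite hornerM hornerX mulrCA mulrA.
  apply/norm_cvg0P; apply: (@squeeze_cvgr _ _ _ _ (fun=> 0) (fun h => C * `|h|)).
  + by near=> h; rewrite normr_ge0/=; exact: HC'.
  + exact: cvg_cst.
  + rewrite -[X in _ --> X](mulr0 C) -[X in C * X](normr0 R).
    apply: cvgM; first exact: cvg_cst.
    by apply: cvg_norm; apply: cvg_within_filter; exact: cvg_id.
Unshelve. all: by end_near. Qed.

End Flat.

Section Bump.
Context {R : realType}.
Implicit Types (p q : {poly R}) (a b x : R).

Lemma is_derive_subr (f : R -> R) (f' a x : R) : is_derive (x - a) 1 f f' ->
  is_derive x 1 (fun y => f (y - a)) f'.
Proof.
move=> H; have := @is_derive_affine _ f f' 1 (- a) x.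
rewrite !mul1r => /(_ H).
by congr is_derive; apply/funext => y; rewrite mul1r.
Qed.

Lemma is_derive_reflect (f : R -> R) (f' b x : R) : is_derive (b - x) 1 f f' ->
  is_derive x 1 (fun y => f (b - y)) (- f').
Proof.
move=> H; have := @is_derive_affine _ f f' (-1) b x.
rewrite !mulN1r addrC => /(_ H).
by congr is_derive; apply/funext => y; rewrite mulN1r addrC.
Qed.

Lemma is_derive_mul (f g : R -> R) (f' g' x : R) : is_derive x 1 f f' ->
  is_derive x 1 g g' -> is_derive x 1 (fun y => f y * g y) (f' * g x + f x * g').
Proof.
move=> ff' gg'; apply: (is_derive_eq (is_deriveM ff' gg')).
by rewrite addrC /GRing.scale /= [g x * _]mulrC.
Qed.

(** Two independent polynomials are kept, one for each endpoint: the derivative is then a difference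
    of two members of the same family, and smoothness follows by induction. *)
Definition flat2 a b p q x : R := flat p (x - a) * flat q (b - x).

Let dp p : {poly R} := 'X^2 * (p - p^`()).

Lemma is_derive_flat2 a b p q x : is_derive x 1 (flat2 a b p q)
  (flat2 a b ('X^2 * (p - p^`())) q x - flat2 a b p ('X^2 * (q - q^`())) x).
Proof.
have := is_derive_mul
  (is_derive_subr (is_derive_flat p (x - a)))
  (is_derive_reflect (is_derive_flat q (b - x))).
by rewrite mulrN.
Qed.

Lemma smooth_flat2 a b p q : smooth (flat2 a b p q).
Proof.
move=> n; elim: n p q => [//|n IH] p q.
exists (fun x => flat2 a b (dp p) q x - flat2 a b p (dp q) x).
  by move=> x; exact: is_derive_flat2.
apply: times_derivableD => //.
have -> : (fun x => - flat2 a b p (dp q) x) = (fun x => -1 * flat2 a b p (dp q) x).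
  by apply/funext => x; rewrite mulN1r.
apply: times_derivableM => //; exact: times_derivable_cst.
Qed.

Definition bumpR a b : R -> R := flat2 a b 1 1.

Lemma smooth_bump a b : smooth (bumpR a b). Proof. exact: smooth_flat2. Qed.

Lemma flat2_out a b p q x : x <= a \/ b <= x -> flat2 a b p q x = 0.
Proof.
rewrite /flat2 /flat !subr_gt0 => -[|].
- by rewrite leNgt => /negbTE ->; rewrite mul0r.
- by rewrite leNgt => /negbTE ->; rewrite mulr0.
Qed.

Lemma bump_gt0 a b x : a < x < b -> 0 < bumpR a b x.
Proof.
move=> /andP[ax xb]; rewrite /bumpR /flat2 /flat !subr_gt0 ax xb !hornerC !mul1r.
by rewrite mulr_gt0 ?expR_gt0.
Qed.

Lemma bump_ge0 a b x : 0 <= bumpR a b x.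
Proof.
have [ax|xa] := ltP a x; last by rewrite /bumpR flat2_out//; left.
have [xb|bx] := ltP x b; last by rewrite /bumpR flat2_out//; right.
by rewrite ltW// bump_gt0// ax.
Qed.

Lemma bump_neq0 a b x : bumpR a b x != 0 -> a < x < b.
Proof.
move=> h; apply/andP; split; rewrite ltNge; apply/negP => xab; move: h.
- by rewrite /bumpR flat2_out ?eqxx//; left.
- by rewrite /bumpR flat2_out ?eqxx//; right.
Qed.

Definition bumpR' a b x : R := flat2 a b (dp 1) 1 x - flat2 a b 1 (dp 1) x.

Definition bumpR'' a b x : R := flat2 a b (dp (dp 1)) 1 x
  - 2 * flat2 a b (dp 1) (dp 1) x + flat2 a b 1 (dp (dp 1)) x.

Lemma is_derive_bump a b x : is_derive x 1 (bumpR a b) (bumpR' a b x).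
Proof. exact: is_derive_flat2. Qed.

Lemma is_derive_bump' a b x : is_derive x 1 (bumpR' a b) (bumpR'' a b x).
Proof.
apply: (is_derive_eq (is_deriveB (is_derive_flat2 a b (dp 1) 1 x)
   (is_derive_flat2 a b 1 (dp 1) x))).
by rewrite /bumpR'' /dp; ring.
Qed.

Lemma bumpR''_out a b x : x <= a \/ b <= x -> bumpR'' a b x = 0.
Proof. by move=> H; rewrite /bumpR'' !flat2_out// mulr0 subr0 addr0. Qed.

(* The right-hand side is g''/g for g = bumpR a b, s = 1/(x-a), r = 1/(b-x). *)
Let quartic_ge (M s r : R) : 0 < s -> 0 < r -> r <= M -> r <= s ->
  - ((8 + 2 * M ^+ 2) ^+ 2 / 2) <=
  (s ^+ 4 - 2 * s ^+ 3) - 2 * (s ^+ 2 * r ^+ 2) + (r ^+ 4 - 2 * r ^+ 3).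
Proof.
move=> s0 r0 rM rs.
have r2M : r ^+ 2 <= M ^+ 2 by rewrite ler_pXn2r// nnegrE ltW// (lt_le_trans r0).
have r3s : r ^+ 3 <= s ^+ 3 by rewrite ler_pXn2r// nnegrE ltW.
have r4 : 0 <= r ^+ 4 by rewrite exprn_ge0// ltW.
have h1 : s ^+ 2 * r ^+ 2 <= s ^+ 2 * M ^+ 2 by rewrite ler_wpM2l// sqr_ge0.
(* By [r3s] the cubic terms cost at most 4 s^3, and [h2] bounds this by s^4/2 + 8 s^2. With N = 8 +
   2 M^2 there remains s^4/2 - N s^2, which is at least - N^2/2 by completing the square ([h3]). *)
have h2 : 0 <= s ^+ 2 * (s - 4) ^+ 2 by rewrite mulr_ge0// sqr_ge0.
have h3 : 0 <= (s ^+ 2 - (8 + 2 * M ^+ 2)) ^+ 2 by rewrite sqr_ge0.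
move: h1 h2 h3 r3s r4; rewrite !expr2 !exprS; nra.
Qed.

(** Near an endpoint g''/g is dominated by a positive fourth power of the inverse distance, so this
    quotient is bounded below although it is unbounded above. *)
Lemma bumpR''_ge a b : a < b ->
  exists2 K, 0 <= K & forall x, - K * bumpR a b x <= bumpR'' a b x.
Proof.
move=> ab; pose M := 2 / (b - a); exists ((8 + 2 * M ^+ 2) ^+ 2 / 2).
  by rewrite divr_ge0// sqr_ge0.
move=> x.
have [ax|xa] := ltP a x; last first.
  by rewrite bumpR''_out ?/bumpR ?flat2_out ?mulr0//; left.
have [xb|bx] := ltP x b; last first.
  by rewrite bumpR''_out ?/bumpR ?flat2_out ?mulr0//; right.
have d1 : (1 : {poly R})^`() = 0 by rewrite -[1]/(1%:P) derivC.
have e1 : dp 1 = 'X^2 by rewrite /dp d1 subr0 mulr1.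
have e2 s : (dp 'X^2).[s] = s ^+ 4 - 2 * s ^+ 3.
  by rewrite /dp derivXn !hornerE /=; ring.
rewrite /bumpR'' /bumpR /flat2 /flat !subr_gt0 ax xb !e1 !e2 !hornerXn.
rewrite !hornerC !mul1r.
set s := (x - a)^-1; set r := (b - x)^-1.
have s0 : 0 < s by rewrite invr_gt0 subr_gt0.
have r0 : 0 < r by rewrite invr_gt0 subr_gt0.
set E1 := expR (- s); set E2 := expR (- r).
have -> : (s ^+ 4 - 2 * s ^+ 3) * E1 * E2 - 2 * (s ^+ 2 * E1 * (r ^+ 2 * E2)) +
     E1 * ((r ^+ 4 - 2 * r ^+ 3) * E2) =
  ((s ^+ 4 - 2 * s ^+ 3) - 2 * (s ^+ 2 * r ^+ 2) + (r ^+ 4 - 2 * r ^+ 3)) * (E1 * E2).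
  by ring.
rewrite ler_wpM2r ?mulr_ge0 ?expR_ge0//.
have ba : 0 < b - a by rewrite subr_gt0.
have MS (t : R) : (b - a) / 2 <= t -> t^-1 <= M.
  move=> ht; rewrite -[M]invrK lef_pV2 ?posrE; last 2 first.
  - by apply: lt_le_trans ht; rewrite divr_gt0.
  - by rewrite invr_gt0 divr_gt0.
  - by rewrite /M invf_div.
(* The smaller of [r] and [s] belongs to the farther endpoint, at distance at least (b - a)/2, hence
   is at most [M]. The two cases are symmetric. *)
have [rs|sr] := leP r s.
  apply: quartic_ge => //; apply: MS.
  by move: rs; rewrite /r /s lef_pV2 ?posrE ?subr_gt0//; lra.
have := @quartic_ge M r s r0 s0; rewrite (ltW sr) => H.
apply: le_trans (H _ isT) _; last by rewrite [s ^+ 2 * _]mulrC; lra.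
apply: MS; move: (ltW sr); rewrite /r /s lef_pV2 ?posrE ?subr_gt0//; lra.
Qed.

End Bump.

(** * Tensor products as test functions *)

Section Tensor.
Context {R : realType}.
Implicit Types (F : R * R -> R) (f g : R -> R) (p : R * R).

(** Equality already holds between difference quotients, so existence and value of a partial
    derivative transfer together to the slice. *)
Lemma quotient_fst F p : (fun h : R => h^-1 *: (F (h *: (1, 0) + p) - F p)) =
  (fun h : R => h^-1 *: (F (h *: (1 : R) + p.1, p.2) - F (p.1, p.2))).
Proof.
apply/funext => h; case: p => x y /=; congr (_ *: (F _ - _)).
by apply/pair_equal_spec; split => //=; rewrite scaler0 add0r.
Qed.

Lemma quotient_snd F p : (fun h : R => h^-1 *: (F (h *: (0, 1) + p) - F p)) =
  (fun h : R => h^-1 *: (F (p.1, h *: (1 : R) + p.2) - F (p.1, p.2))).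
Proof.
apply/funext => h; case: p => x y /=; congr (_ *: (F _ - _)).
by apply/pair_equal_spec; split => //=; rewrite scaler0 add0r.
Qed.

Lemma is_derive_fstP F p d :
  is_derive p (1, 0) F d <-> is_derive p.1 1 (fun x : R => F (x, p.2)) d.
Proof.
split => -[dF <-]; apply: DeriveDef.
- by move: dF; rewrite /derivable quotient_fst.
- by rewrite /derive quotient_fst.
- by move: dF; rewrite /derivable quotient_fst.
- by rewrite /derive quotient_fst.
Qed.

Lemma is_derive_sndP F p d :
  is_derive p (0, 1) F d <-> is_derive p.2 1 (fun y : R => F (p.1, y)) d.
Proof.
split => -[dF <-]; apply: DeriveDef.
- by move: dF; rewrite /derivable quotient_snd.
- by rewrite /derive quotient_snd.
- by move: dF; rewrite /derivable quotient_snd.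
- by rewrite /derive quotient_snd.
Qed.

(** The strict inequalities describe an open set, which is why the property passes to
    derivatives. *)
Definition vanishes_outside (a b : R) f := forall x, x < a \/ b < x -> f x = 0.

Lemma vanishes_outside_itv a b f x : vanishes_outside a b f ->
  f x != 0 -> x \in `[a, b].
Proof.
move=> f0 fx; rewrite in_itv /=; apply/andP; split; rewrite leNgt; apply/negP => H.
- by move: fx; rewrite f0 ?eqxx//; left.
- by move: fx; rewrite f0 ?eqxx//; right.
Qed.

Lemma vanishes_outside_derive a b f g : (forall x : R, is_derive x 1 f (g x)) ->
  vanishes_outside a b f -> vanishes_outside a b g.
Proof.
move=> fg f0 x xab.
suff fx : is_derive x 1 f 0.
  by rewrite -(@derive_val _ _ _ _ _ _ _ (fg x)) (@derive_val _ _ _ _ _ _ _ fx).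
apply: (@near_eq_is_derive _ _ _ (cst (0 : R))) (is_derive_cst _ _ _).
case: xab => h.
- by near=> z; rewrite f0//; left; near: z; exact: lt_nbhsl.
- by near=> z; rewrite f0//; right; near: z; exact: lt_nbhsr.
Unshelve. all: by end_near. Qed.

Definition tensor f g p : R := f p.1 * g p.2.

Lemma is_derive_tensor1 f f' g : (forall x : R, is_derive x 1 f (f' x)) ->
  forall p, is_derive p (1, 0) (tensor f g) (tensor f' g p).
Proof.
move=> ff' p; apply/is_derive_fstP; rewrite /tensor /=.
have := is_derive_mul (ff' p.1) (is_derive_cst (g p.2) p.1 1).
by rewrite mulr0 addr0.
Qed.

Lemma is_derive_tensor2 f g g' : (forall x : R, is_derive x 1 g (g' x)) ->
  forall p, is_derive p (0, 1) (tensor f g) (tensor f g' p).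
Proof.
move=> gg' p; apply/is_derive_sndP; rewrite /tensor /=.
have := is_derive_mul (is_derive_cst (f p.1) p.2 1) (gg' p.2).
by rewrite mul0r add0r.
Qed.

Lemma pdx_tensor f f' g : (forall x : R, is_derive x 1 f (f' x)) ->
  pdx (tensor f g) = tensor f' g.
Proof.
by move=> ff'; apply/funext => p; case: (is_derive_tensor1 g ff' p).
Qed.

Lemma pdy_tensor f g g' : (forall x : R, is_derive x 1 g (g' x)) ->
  pdy (tensor f g) = tensor f g'.
Proof.
by move=> gg'; apply/funext => p; case: (is_derive_tensor2 f gg' p).
Qed.

Lemma continuous_tensor f g : continuous f -> continuous g ->
  continuous (tensor f g).
Proof.
move=> cf cg p; apply: cvgM.
- by apply: (@continuous_comp _ _ _ fst f); [exact: cvg_fst | exact: cf].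
- by apply: (@continuous_comp _ _ _ snd g); [exact: cvg_snd | exact: cg].
Qed.

Lemma Ck_tensor k f g : smooth f -> smooth g -> Ck k (tensor f g).
Proof.
elim: k f g => [|k IH] f g sf sg /=.
  by apply: continuous_tensor; exact: smooth_continuous.
have [f' ff' sf'] := smooth_ex_derive sf.
have [g' gg' sg'] := smooth_ex_derive sg.
split.
- by apply: continuous_tensor; exact: smooth_continuous.
- move=> p; split.
  + by case: (is_derive_tensor1 g ff' p).
  + by case: (is_derive_tensor2 f gg' p).
- by rewrite (pdx_tensor _ ff'); exact: IH.
- by rewrite (pdy_tensor _ gg'); exact: IH.
Qed.

Lemma test_function_tensor f g (A B a b : R) : smooth f -> smooth g ->
  vanishes_outside A B f -> vanishes_outside a b g ->
  test_function2 (tensor f g).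
Proof.
move=> sf sg f0 g0; split; first by move=> k; exact: Ck_tensor.
apply: (@subclosed_compact _ _ (`[A, B] `*` `[a, b])).
- exact: closed_closure.
- by apply: compact_setX; exact: segment_compact.
- have cl : closed (`[A, B] `*` `[a, b] : set (R * R)).
    apply: compact_closed; first exact: norm_hausdorff.
    by apply: compact_setX; exact: segment_compact.
  rewrite [X in _ `<=` X](closure_id _).1//; apply: closureS => -[x y] /=.
  rewrite /tensor /= mulf_eq0 negb_or => /andP[fx gy].
  by split; [exact: vanishes_outside_itv f0 fx | exact: vanishes_outside_itv g0 gy].
Qed.

End Tensor.

(** * Integration on the line and on the plane *)

Section PlaneIntegral.
Context {R : realType}.
Local Notation T := (measurableTypeR R).
Local Notation leb := (@lebesgue_measure R).
Implicit Types (F : R * R -> R) (f g : R -> R).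

(** An open set is the union of the squares with rational centre and radius that it contains, and
    these are countably many measurable rectangles. *)
Lemma open_measurable2 (O : set (R * R)) :
  open O -> measurable (O : set (T * T)).
Proof.
move=> oO.
pose box (q : rat * rat * rat) : set (R * R) :=
  ball (ratr q.1.1 : R) (ratr q.2) `*` ball (ratr q.1.2 : R) (ratr q.2).
pose G q : set (T * T) := if `[< box q `<=` O >] then box q else set0.
suff -> : (O : set (T * T)) = \bigcup_q G q.
  apply: countable_bigcupT_measurable; first exact: countableP.
  move=> q; rewrite /G; case: asboolP => _ //.
  by apply: measurableX; rewrite ball_itv; exact: measurable_itv.
apply/seteqP; split => [[x y] Oxy|[x y] [q _]]; last first.
  by rewrite /G; case: asboolP => // H /H.
have : nbhs (x, y) O by apply: open_nbhs_nbhs.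
move=> /nbhs_ballP[e /= e0 xyO].
(* A square of radius r < e/2 whose centre is within r of (x, y) stays in the ball of radius e. *)
have [|r] := @rat_in_itvoo R 0 (e / 2); first by rewrite divr_gt0.
rewrite in_itv/= => /andP[r0 re].
have near_rat (z : R) : exists q : rat, `|z - ratr q| < ratr r.
  have [|q] := @rat_in_itvoo R z (z + ratr r); first by rewrite ltrDl.
  rewrite in_itv/= => /andP[zq qz]; exists q.
  by rewrite distrC gtr0_norm ?subr_gt0// ltrBlDl.
have [q1 xq1] := near_rat x; have [q2 yq2] := near_rat y.
have sub : box (q1, q2, r) `<=` O.
  move=> [x' y'] [/= h1 h2]; apply: xyO; split => /=.
  - by apply: (@le_ball _ _ _ (ratr r + ratr r)); [lra|];
      apply: ball_triangle h1; rewrite -ball_normE.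
  - by apply: (@le_ball _ _ _ (ratr r + ratr r)); [lra|];
      apply: ball_triangle h2; rewrite -ball_normE.
exists (q1, q2, r) => //; rewrite /G asboolT//.
by split => /=; apply: ball_sym; rewrite -ball_normE.
Qed.

Lemma continuous_measurable_fun2 F :
  continuous F -> measurable_fun setT (F : T * T -> R).
Proof.
move=> /continuousP cF; apply: (measurability _ (RGenOpens.measurableE R)).
move=> _ [_ [a [b ->] <-]]; rewrite setTI; apply: open_measurable2.
exact/cF/interval_open.
Qed.

Lemma bounded_box_integrable F (A B a b M : R) :
  measurable_fun setT (F : T * T -> R) -> (forall p, `|F p| <= M) ->
  (forall x y, x < A \/ B < x \/ y < a \/ b < y -> F (x, y) = 0) ->
  (leb \x leb)%E.-integrable setT (EFin \o (F : T * T -> R)).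
Proof.
move=> mF FM F0; pose D : set (T * T) := `[A, B] `*` `[a, b].
have mD : measurable D by apply: measurableX; exact: measurable_itv.
have -> : EFin \o (F : T * T -> R) = (EFin \o (F : T * T -> R)) \_ D.
  apply/funext => -[x y]; rewrite patchE; case: ifPn => // /negP H /=.
  congr EFin; apply: F0; apply: contrapT => /not_orP[/negP h1 /not_orP[/negP h2]].
  move=> /not_orP[/negP h3 /negP h4]; apply: H; rewrite inE; split => /=.
  - by rewrite in_itv /= !leNgt h1 h2.
  - by rewrite in_itv /= !leNgt h3 h4.
apply/(integrable_mkcond _ mD); apply: measurable_bounded_integrable => //.
- rewrite /=; have -> : (leb \x leb)%E D = (leb `[A, B] * leb `[a, b])%E.
    by rewrite /D; apply: product_measure1E; exact: measurable_itv.
  rewrite !lebesgue_measure_itv /=.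
  by case: ifP; case: ifP => _ _; rewrite ?mule0 ?mul0e// -!EFinB -EFinM ltry.
- exact: measurable_funTS.
- exists M; split; first exact: num_real.
  by move=> z Mz p _ /=; apply: le_trans (FM p) (ltW Mz).
Qed.

(** Integrability of every slice makes the inner extended integral finite, so that passing to its
    real value loses nothing. *)
Lemma fubini_Rintegral F :
  (leb \x leb)%E.-integrable setT (EFin \o (F : T * T -> R)) ->
  (forall x, leb.-integrable setT (EFin \o (fun y => F (x, y)))) ->
  leb.-integrable setT (EFin \o (fun x => \int[leb]_y F (x, y))) /\
  \int[(leb \x leb)%E]_p F p = \int[leb]_x \int[leb]_y F (x, y).
Proof.
move=> iF iFx.
have E : fubini_F leb (EFin \o (F : T * T -> R)) =
    EFin \o (fun x => \int[leb]_y F (x, y)).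
  apply/funext => x; rewrite /fubini_F /Rintegral /= fineK//.
  exact: (integrable_fin_num measurableT (iFx x)).
split; first by rewrite -E; exact: integrable_fubini_F.
rewrite /Rintegral -[in LHS]integral12_prod_meas1//; congr fine.
by apply: eq_integral => x _; rewrite -/(fubini_F _ _ x) E.
Qed.

Lemma continuous_compact_support_integrable f (a b : R) : continuous f ->
  vanishes_outside a b f ->
  leb.-integrable setT (EFin \o f).
Proof.
move=> cf f0.
have -> : EFin \o f = (EFin \o f) \_ (`[a, b] : set T).
  apply/funext => x; rewrite patchE; case: ifPn => // /negP H /=.
  congr EFin; apply: f0; apply: contrapT => /not_orP[/negP h1 /negP h2].
  by apply: H; rewrite inE /= in_itv /= !leNgt h1 h2.
have mI : measurable (`[a, b] : set T) by exact: measurable_itv.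
apply/(integrable_mkcond _ mI).
apply: continuous_compact_integrable; first exact: segment_compact.
exact: continuous_subspaceT.
Qed.

Lemma Rintegral_compact_support f (a b : R) :
  vanishes_outside a b f ->
  \int[leb]_x f x = \int[leb]_(x in `[a, b]) f x.
Proof.
move=> f0; rewrite [RHS]Rintegral_mkcond; congr Rintegral.
apply/funext => x; rewrite patchE; case: ifPn => // /negP H /=.
apply: f0; apply: contrapT => /not_orP[/negP h1 /negP h2].
by apply: H; rewrite inE /= in_itv /= !leNgt h1 h2.
Qed.

Lemma Rintegral_derive f g (a b : R) : a < b ->
  (forall x : R, is_derive x 1 f (g x)) -> continuous g ->
  vanishes_outside a b g ->
  \int[leb]_x g x = f b - f a.
Proof.
move=> ab fg cg g0; rewrite (Rintegral_compact_support g0) /Rintegral.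
rewrite (@continuous_FTC2 _ g f)//.
- exact: continuous_subspaceT.
- have cf := is_derive_continuous fg; split.
  + by move=> x _; case: (fg x).
  + by apply: cvg_at_right_filter; exact: cf.
  + by apply: cvg_at_left_filter; exact: cf.
- by move=> x _; rewrite derive1E; case: (fg x).
Qed.

(** The primitive is the integral from -oo; the value [f b] at the right end is therefore the total
    mass of [g]. *)
Lemma compact_support_primitive g (a b : R) : a < b -> continuous g ->
  vanishes_outside a b g ->
  exists f, [/\ forall x : R, is_derive x 1 f (g x),
    forall x, x < a -> f x = 0 & forall x, b <= x -> f x = f b].
Proof.
move=> ab cg g0.
have ig := continuous_compact_support_integrable cg g0.
pose f x := \int[leb]_(t in `]-oo, x]) g t.
have fg (x : R) : is_derive x 1 f (g x).
  have ix : leb.-integrable [set` Interval -oo%O (BRight (x + 1))] (EFin \o g).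
    by apply: integrableS ig => //; exact: measurable_itv.
  have x1 : x < x + 1 by rewrite ltrDl.
  have [df <-] := continuous_FTC1 x1 ix (ltNyr x) (cg x).
  by rewrite derive1E; exact: DeriveDef.
exists f; split => // x xab.
- rewrite /f -(Rintegral_set0 leb g) Rintegral_mkcond [RHS]Rintegral_mkcond.
  congr Rintegral; apply/funext => z; rewrite !patchE in_set0.
  case: ifPn => //; rewrite inE /= in_itv /= => zx; apply: g0; left.
  exact: le_lt_trans xab.
- have [->//|bx] := eqVneq x b.
  have {}bx : b < x by rewrite lt_neqAle eq_sym bx.
  have cf := is_derive_continuous fg.
  have [z] := @MVT _ f g b x bx (fun z _ => fg z) (continuous_subspaceT cf).
  rewrite in_itv /= => /andP[bz _]; rewrite g0; last by right.
  by rewrite mul0r => /eqP; rewrite subr_eq0 => /eqP.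
Qed.

Lemma is_derive_ndecr f g : (forall x : R, is_derive x 1 f (g x)) ->
  (forall x, 0 <= g x) -> forall x y, x <= y -> f x <= f y.
Proof.
move=> fg g0 x y xy; have cf := is_derive_continuous fg.
have [z _ E] := @MVT_segment _ f g x y xy (fun z _ => fg z) (continuous_subspaceT cf).
by rewrite -subr_ge0 E mulr_ge0// subr_ge0.
Qed.

(** A nondecreasing function with equal end values is constant in between, so its derivative
    vanishes there. *)
Lemma is_derive_eq_ends f g (a b : R) : (forall x : R, is_derive x 1 f (g x)) ->
  (forall x, 0 <= g x) -> f a = f b -> forall x, a < x < b -> g x = 0.
Proof.
move=> fg g0 fab x /andP[ax xb]; have mono := is_derive_ndecr fg g0.
have fx : is_derive x 1 f 0.
  apply: (@near_eq_is_derive _ _ _ (cst (f a))) (is_derive_cst _ _ _).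
  near=> z; apply/eqP; rewrite eq_le {2}fab !mono//.
  - by apply/ltW; near: z; exact: lt_nbhsl.
  - by apply/ltW; near: z; exact: lt_nbhsr.
by rewrite -(@derive_val _ _ _ _ _ _ _ (fg x)) (@derive_val _ _ _ _ _ _ _ fx).
Unshelve. all: by end_near. Qed.

Lemma continuous_slice1 F (y : R) : continuous F -> continuous (fun x => F (x, y)).
Proof.
move=> cF x; apply: (@continuous_comp _ _ _ (fun x => (x, y)) F); last exact: cF.
by apply: (@cvg_pair _ _ _ _ (nbhs x) (nbhs y)); [exact: cvg_id | exact: cvg_cst].
Qed.

Lemma continuous_slice2 F (x : R) : continuous F -> continuous (fun y => F (x, y)).
Proof.
move=> cF y; apply: (@continuous_comp _ _ _ (fun y => (x, y)) F); last exact: cF.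
by apply: (@cvg_pair _ _ _ _ (nbhs x) (nbhs y)); [exact: cvg_cst | exact: cvg_id].
Qed.

Lemma continuous_box_bounded F (A B a b : R) : continuous F ->
  exists M, forall x y, x \in `[A, B] -> y \in `[a, b] -> `|F (x, y)| <= M.
Proof.
move=> cF; have cpt : compact (`[A, B] `*` `[a, b] : set (R * R)).
  by apply: compact_setX; exact: segment_compact.
have /compact_bounded[M [_ HM]] := continuous_compact (continuous_subspaceT cF) cpt.
exists (M + 1) => x y xAB yab.
by apply: HM; [rewrite ltrDl | exists (x, y)].
Qed.

(** Dominated convergence: a constant bounds [F] on the compact box over [x - 1, x + 1]. *)
Lemma continuous_slice_integral F (a b : R) : continuous F ->
  continuous (fun x => \int[leb]_(y in `[a, b]) F (x, y)).
Proof.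
move=> cF x.
have [M HM] := continuous_box_bounded (x - 1) (x + 1) a b cF.
have cptI : compact (`[a, b] : set R) by exact: segment_compact.
apply: (@continuity_under_integral R _ T leb (fun x y => F (x, y)) `[a, b]
  _ (x - 1) (x + 1) _ _ (cst M)).
- exact: measurable_itv.
- move=> z _; apply: continuous_compact_integrable => //.
  by apply: continuous_subspaceT; exact: continuous_slice2.
- by apply: aeW => y _ z _; exact: continuous_slice1.
- apply: continuous_compact_integrable => //.
  by apply: continuous_subspaceT => z; exact: cvg_cst.
- move=> z zx; apply: aeW => y yab /=; apply: HM => //.
  by apply: subset_itv_oo_cc; exact: zx.
- by rewrite inE /= in_itv /= ltrBlDr ltrDl ltr01.
Qed.

End PlaneIntegral.

(** * The one-dimensional strong minimum principle *)

Section Barrier.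
Context {R : realType}.

(* [f = exp(l2 x) q] turns the operator [f'' - (l1 + l2) f' + l1 l2 f] into
   [exp(l1 x) (exp(- (l1 - l2) x) q')'], so that two integrations of a
   combination of three translates of [rho] solve the equation; the weights are
   those for which the solution has compact support. *)
Lemma barrier (x0 r e l1 l2 : R) : 0 < r -> 0 < e ->
  let rho := bumpR (x0 - e) (x0 + e) in let k := expR (- ((l1 - l2) * r)) in
  exists f f' f'' : R -> R, exists A B : R,
  [/\ forall x : R, is_derive x 1 f (f' x), forall x : R, is_derive x 1 f' (f'' x),
      smooth f, forall x, 0 <= f x & vanishes_outside A B f] /\
  forall x, f'' x - (l1 + l2) * f' x + l1 * l2 * f x =
    expR (l1 * x) * (rho (x + r) - (1 + k) * rho x + k * rho (x - r)).
Proof.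
move=> r0 e0 rho k.
have srho : smooth rho := smooth_bump _ _.
have rho_out : vanishes_outside (x0 - e) (x0 + e) rho.
  by move=> x [h|h]; apply: flat2_out; [left|right]; exact: ltW.
have [|S [dS S0 SB]] := compact_support_primitive _ (smooth_continuous srho) rho_out.
  by rewrite ltrBlDr -addrA ltrDl addr_gt0.
have sS : smooth S := smooth_primitive dS srho.
have Smono := is_derive_ndecr dS (bump_ge0 _ _).
(* [S] rises from 0 to a constant, so its increment over a step [r] is nonnegative and compactly
   supported. The same device turns [J] into [f] below. *)
pose T (x : R) := S (x + r) - S x.
have sT : smooth T by apply: smoothB => //; exact: smooth_shift.
have T0 (x : R) : 0 <= T x by rewrite subr_ge0 Smono// lerDl ltW.
have dT (x : R) : is_derive x 1 T (rho (x + r) - rho x).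
  have dS' : is_derive x 1 (fun x => S (x + r)) (rho (x + r)).
    by have := @is_derive_subr _ S (rho (x + r)) (- r) x; rewrite opprK; apply.
  exact: is_deriveB dS' (dS x).
have T_out : vanishes_outside (x0 - e - r) (x0 + e) T.
  move=> x [h|h]; rewrite /T.
  - have h1 : x + r < x0 - e by lra.
    have h2 : x < x0 - e by lra.
    by rewrite (S0 _ h1) (S0 _ h2) subrr.
  - have h1 : x0 + e <= x + r by lra.
    by rewrite (SB _ h1) (SB _ (ltW h)) subrr.
pose nu := l1 - l2.
pose H (x : R) := expR (nu * x) * T x.
have sH : smooth H by apply: smoothM => //; exact: smooth_expR.
have H_out : vanishes_outside (x0 - e - r) (x0 + e) H.
  by move=> x /T_out; rewrite /H => ->; rewrite mulr0.
have [|J [dJ J0 JB]] := compact_support_primitive _ (smooth_continuous sH) H_out.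
  by lra.
have sJ : smooth J := smooth_primitive dJ sH.
have Jmono : forall x y, x <= y -> J x <= J y.
  by apply: (is_derive_ndecr dJ) => x; rewrite mulr_ge0// expR_ge0.
pose f (x : R) := expR (l2 * x) * (J x - J (x - r)).
(* This is f' - l2 f: since l2 + nu = l1, the weight in [H] becomes exp(l1 x), and the shift by [r]
   produces the factor [k]. *)
pose w (x : R) := expR (l1 * x) * (T x - k * T (x - r)).
pose w' (x : R) := l1 * w x +
  expR (l1 * x) * (rho (x + r) - (1 + k) * rho x + k * rho (x - r)).
have shift (h h' : R -> R) (x : R) : (forall x : R, is_derive x 1 h (h' x)) ->
    is_derive x 1 (fun x => h (x - r)) (h' (x - r)).
  by move=> hh'; exact: is_derive_subr.
have df (x : R) : is_derive x 1 f (l2 * f x + w x).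
  have := is_derive_mul (is_derive_expR_scale l2 x)
    (is_deriveB (dJ x) (shift _ _ x dJ)).
  move/is_derive_eq; apply; rewrite /f /w /H /k !fctE.
  have -> : expR (nu * (x - r)) = expR (l1 * x) / expR (l2 * x) * expR (- (nu * r)).
    by rewrite -expRB -expRD; congr expR; rewrite /nu; ring.
  have -> : expR (nu * x) = expR (l1 * x) / expR (l2 * x).
    by rewrite -expRB; congr expR; rewrite /nu; ring.
  by rewrite -/nu; field; rewrite expR_eq0.
have dw (x : R) : is_derive x 1 w (w' x).
  have dT' : is_derive x 1 (fun x => T x - k * T (x - r))
     ((rho (x + r) - rho x) - k * (rho (x - r + r) - rho (x - r))).
    have dkT := is_derive_mul (is_derive_cst k x 1) (shift _ _ x dT).
    by have := is_deriveB (dT x) dkT; rewrite mul0r add0r.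
  have := is_derive_mul (is_derive_expR_scale l1 x) dT'.
  by move/is_derive_eq; apply; rewrite /w' /w subrK; ring.
exists f, (fun x => l2 * f x + w x), (fun x => l2 * (l2 * f x + w x) + w' x).
exists (x0 - e - r), (x0 + e + r); split; last first.
  by move=> x; rewrite /w'; ring.
split => //.
- move=> x; have dlf := is_derive_mul (is_derive_cst l2 x 1) (df x).
  by have := is_deriveD dlf (dw x); rewrite mul0r add0r.
- apply: smoothM; first exact: smooth_expR.
  by apply: smoothB => //; exact: smooth_shift.
- move=> x; rewrite mulr_ge0 ?expR_ge0// subr_ge0 Jmono//.
  by rewrite lerBlDr lerDl ltW.
- move=> x [h|h]; rewrite /f.
  + have h1 : x - r < x0 - e - r by lra.
    by rewrite (J0 _ h) (J0 _ h1) subrr mulr0.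
  + have h1 : x0 + e <= x by lra.
    have h2 : x0 + e <= x - r by lra.
    by rewrite (JB _ h1) (JB _ h2) subrr mulr0.
Qed.

End Barrier.

Section StrongMinimumPrinciple.
Context {R : realType}.
Local Notation leb := (@lebesgue_measure R).

(** Weak form of V'' + c V' - K V <= 0: both derivatives fall on the test function, which reverses
    the sign of [c]. *)
Definition supersolution (c K : R) (V : R -> R) :=
  forall (f f' f'' : R -> R) (A B : R),
    (forall x : R, is_derive x 1 f (f' x)) ->
    (forall x : R, is_derive x 1 f' (f'' x)) ->
    smooth f -> (forall x, 0 <= f x) -> vanishes_outside A B f ->
    \int[leb]_x ((f'' x - c * f' x - K * f x) * V x) <= 0.

Lemma strong_minimum_principle (c K : R) (V : R -> R) (x0 x1 : R) :
  0 <= c -> 0 <= K -> continuous V -> (forall x, 0 <= V x) ->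
  supersolution c K V -> V x0 = 0 -> x1 < x0 -> V x1 = 0.
Proof.
move=> c0 K0 cV V0 sV Vx0 x10; apply/eqP/negPn/negP => Vx1.
have {}Vx1 : 0 < V x1 by rewrite lt_neqAle eq_sym Vx1 V0.
(* The exponents have sum [c], and - l1 l2 = (c + K + 1)(K + 1) is at least [K]. *)
pose l1 := c + K + 1; pose l2 := - (K + 1); pose r := x0 - x1.
have r0 : 0 < r by rewrite subr_gt0.
pose k := expR (- ((l1 - l2) * r)).
have k0 : 0 < k by exact: expR_gt0.
have l10 : 0 < l1 by rewrite /l1; lra.
pose d := V x1 / 2; have d0 : 0 < d by rewrite divr_gt0.
(* [m1] is a lower bound for exp(l1 x) V(x) near [x1], and [eta] is the bound on [V] near [x0] that
   keeps (1 + k) exp(l1 x) V(x) below m1/2 there. *)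
pose m1 := d * expR (l1 * (x1 - 1)).
have m10 : 0 < m1 by rewrite mulr_gt0// expR_gt0.
pose eta := m1 / 2 / ((1 + k) * expR (l1 * (x0 + 1))).
have E0 : 0 < (1 + k) * expR (l1 * (x0 + 1)) by rewrite mulr_gt0 ?expR_gt0 ?addr_gt0.
have eta0 : 0 < eta by rewrite !divr_gt0.
have [e1 /= e10 He1] : exists2 e, 0 < e & forall s, `|x1 - s| < e -> d <= V s.
  have : \forall s \near x1, d < V s.
    by apply: (@cvgr_gt _ _ _ _ V (V x1) (cV x1) d); rewrite /d; lra.
  move=> /nbhs_ballP[e /= e0 He]; exists e => // s hs; apply/ltW/He.
  by rewrite -ball_normE.
have [e2 /= e20 He2] : exists2 e, 0 < e & forall s, `|x0 - s| < e -> V s <= eta.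
  have : \forall s \near x0, V s < eta.
    by apply: (@cvgr_lt _ _ _ _ V (V x0) (cV x0) eta); rewrite Vx0.
  move=> /nbhs_ballP[e /= e0 He]; exists e => // s hs; apply/ltW/He.
  by rewrite -ball_normE.
pose e := Num.min 1 (Num.min e1 e2).
have e0 : 0 < e by rewrite !lt_min ltr01 e10.
have ee : [/\ e <= 1, e <= e1 & e <= e2].
  by split; rewrite /e ?ge_min ?lexx ?orbT.
have [ee1 ee2 ee3] := ee.
have [f [f' [f'' [A [B [[df df' sf f0 f_out] Lf]]]]]] := @barrier R x0 r e l1 l2 r0 e0.
rewrite -/k in Lf; set rho := bumpR (x0 - e) (x0 + e) in Lf.
have srho : smooth rho := smooth_bump _ _.
have rho0 : forall x, 0 <= rho x := bump_ge0 _ _.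
have rho_out : vanishes_outside (x0 - e) (x0 + e) rho.
  by move=> x [h|h]; apply: flat2_out; [left|right]; exact: ltW.
have ab : x0 - e < x0 + e by lra.
have [S [dS S0 SB]] := compact_support_primitive ab (smooth_continuous srho) rho_out.
(* This is the mass of [rho]; were it 0, [rho] would vanish at [x0]. *)
have SB0 : 0 < S (x0 + e).
  rewrite lt_neqAle; apply/andP; split; last first.
    by rewrite -(S0 (x0 - e - 1)) ?(is_derive_ndecr dS)//; lra.
  apply/eqP => S00.
  have := @is_derive_eq_ends _ S rho (x0 - e - 1) (x0 + e) dS rho0.
  rewrite S0 ?S00; last by lra.
  move=> /(_ erefl x0) H.
  have : 0 < rho x0 by apply: bump_gt0; lra.
  by rewrite H ?ltxx//; lra.
(* [h] will minorize the tested integrand. Both bumps have the same mass, so its integral is m1/2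
   times that mass, which is positive. *)
pose h x := m1 * rho (x + r) - m1 / 2 * rho x.
have sh : smooth h.
  apply: smoothB; apply: smoothM => //; try exact: smooth_cst.
  exact: smooth_shift.
have h_out : vanishes_outside (x0 - e - r) (x0 + e) h.
  move=> x xab; rewrite /h !rho_out ?mulr0 ?subr0//; first by lra.
  by case: xab => ?; lra.
(* The left end is moved by 1 because [S0] gives zeros of [S] only strictly to the left of x0 -
   e. *)
have h_out' : vanishes_outside (x0 - e - r - 1) (x0 + e) h.
  by move=> x xab; apply: h_out; case: xab => ?; lra.
have inth : \int[leb]_x h x = m1 / 2 * S (x0 + e).
  have dh (x : R) : is_derive x 1 (fun x => m1 * S (x + r) - m1 / 2 * S x) (h x).
    have dS' : is_derive x 1 (fun x => S (x + r)) (rho (x + r)).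
      by have := @is_derive_subr _ S (rho (x + r)) (- r) x; rewrite opprK; apply.
    have d1 := is_derive_mul (is_derive_cst m1 x 1) dS'.
    have d2 := is_derive_mul (is_derive_cst (m1 / 2) x 1) (dS x).
    by have := is_deriveB d1 d2; rewrite !mul0r !add0r.
  have ab' : x0 - e - r - 1 < x0 + e by lra.
  rewrite (Rintegral_derive ab' dh (smooth_continuous sh) h_out').
  have h1 : x0 + e <= x0 + e + r by lra.
  have h2 : x0 - e - r - 1 + r < x0 - e by lra.
  have h3 : x0 - e - r - 1 < x0 - e by lra.
  by rewrite (SB _ h1) (S0 _ h2) (S0 _ h3); field.
have := sV f f' f'' A B df df' sf f0 f_out.
apply/negP; rewrite -ltNge.
have sf' := smooth_derive df sf; have sf'' := smooth_derive df' sf'.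
have f'_out := vanishes_outside_derive df f_out.
have f''_out := vanishes_outside_derive df' f'_out.
apply: (@lt_le_trans _ _ (\int[leb]_x h x)).
  by rewrite inth mulr_gt0// divr_gt0.
apply: le_Rintegral => //.
- exact: continuous_compact_support_integrable (smooth_continuous sh) h_out.
- apply: (@continuous_compact_support_integrable _ _ A B).
    move=> x; apply: cvgM; last exact: cV.
    apply: cvgB; [apply: cvgB|]; last 2 first.
    + by apply: cvgM; [exact: cvg_cst | exact: smooth_continuous].
    + by apply: cvgM; [exact: cvg_cst | exact: smooth_continuous].
    + exact: smooth_continuous.
  by move=> x xab; rewrite f_out// f'_out// f''_out// !mulr0 !subr0 mul0r.
move=> x _.
have cE : l1 + l2 = c by rewrite /l1 /l2; lra.
have KE : K <= - (l1 * l2) by rewrite /l1 /l2; nra.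
(* The nonnegative translate [k * rho (x - r)] is dropped, and l1 l2 is replaced by the larger - K,
   as f >= 0. *)
have step : expR (l1 * x) * (rho (x + r) - (1 + k) * rho x) <=
    f'' x - c * f' x - K * f x.
  apply: (@le_trans _ _ (f'' x - (l1 + l2) * f' x + l1 * l2 * f x)).
    rewrite Lf ler_wpM2l ?expR_ge0// lerDl mulr_ge0// ltW//.
  rewrite cE lerD2l -lerN2 opprK -mulNr ler_wpM2r//.
apply: le_trans (ler_wpM2r (V0 x) step).
rewrite mulrBr mulrBl /h lerB//.
(* The bumps are compared separately. Where one vanishes there is nothing to prove; otherwise x is
   within [e] of [x1] for the first, of [x0] for the second. *)
- have [rx|rx] := eqVneq (rho (x + r)) 0; first by rewrite rx !(mulr0, mul0r).
  have /andP[rx1 rx2] := bump_neq0 rx.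
  have Vx : d <= V x.
    apply: He1; rewrite ltr_norml; rewrite /r in rx1 rx2.
    by apply/andP; split; lra.
  have ex : expR (l1 * (x1 - 1)) <= expR (l1 * x).
    by rewrite ler_expR ler_pM2l//; rewrite /r in rx1 rx2; lra.
  rewrite [leRHS]mulrAC ler_wpM2r// /m1 mulrC ler_pM ?expR_ge0// ltW//.
- have [rx|rx] := eqVneq (rho x) 0; first by rewrite rx !(mulr0, mul0r).
  have /andP[rx1 rx2] := bump_neq0 rx.
  have Vx : V x <= eta by apply: He2; rewrite ltr_norml; apply/andP; split; lra.
  have ex : expR (l1 * x) <= expR (l1 * (x0 + 1)) by rewrite ler_expR ler_pM2l//; lra.
  have -> : expR (l1 * x) * ((1 + k) * rho x) * V x =
    (1 + k) * expR (l1 * x) * V x * rho x by ring.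
  rewrite ler_wpM2r//.
  have -> : m1 / 2 = (1 + k) * expR (l1 * (x0 + 1)) * eta.
    by rewrite /eta [RHS]mulrC divfK// gt_eqF.
  rewrite ler_pM// ?mulr_ge0 ?expR_ge0 ?addr_ge0 ?(ltW k0)//.
  by rewrite ler_wpM2l// addr_ge0// ltW.
Qed.

End StrongMinimumPrinciple.

(** * Reduction of the equation to one dimension *)

Section Pattern.
Context {R : realType}.
Local Notation leb := (@lebesgue_measure R).
Local Notation T := (measurableTypeR R).

Lemma mu_bounds (x : R) : -1 <= mu x <= 1.
Proof. by rewrite /mu; case: ifP => _; lra. Qed.

Lemma measurable_mu : measurable_fun setT (mu : T -> R).
Proof.
apply: measurable_fun_if => //.
- by apply: measurable_fun_ltr => //; exact: measurable_cst.
Qed.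

(** With the test function f g', a single integration by parts in y differentiates the equation in
    y, so that C^1 regularity of [u] suffices. *)
Lemma supersolution_of_pattern (c : R) (u : R * R -> R) (a b : R) : a < b ->
  Ck 1 u -> distributional_solution2 c u ->
  (forall p, pdy u p <= 0) -> (forall p, `|u p| <= 1) ->
  exists2 K, 0 <= K & supersolution c K
    (fun x => \int[leb]_(y in `[a, b]) (- pdy u (x, y) * bumpR a b y)).
Proof.
move=> ab [cu du cdx cv] sol v_le0 u_le1.
set v := pdy u in v_le0 cv *.
have dv (x y : R) : is_derive y 1 (fun y => u (x, y)) (v (x, y)).
  apply/(is_derive_sndP u (x, y)); apply: DeriveDef => //.
  by case: (du (x, y)).
have [K1 K10 g2ge] := bumpR''_ge ab.
set g := bumpR a b in g2ge *; set g2 := bumpR'' a b in g2ge.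
pose g1 := bumpR' a b.
have dg : forall y : R, is_derive y 1 g (g1 y) := is_derive_bump a b.
have dg1 : forall y : R, is_derive y 1 g1 (g2 y) := is_derive_bump' a b.
have sg : smooth g := smooth_bump a b.
have sg1 := smooth_derive dg sg; have sg2 := smooth_derive dg1 sg1.
have [g3 dg2 sg3] := smooth_ex_derive sg2.
have cg := smooth_continuous sg; have cg1 := smooth_continuous sg1.
have cg2 := smooth_continuous sg2; have cg3 := smooth_continuous sg3.
have g_out : vanishes_outside a b g.
  by move=> y [h|h]; apply: flat2_out; [left|right]; exact: ltW.
have g1_out := vanishes_outside_derive dg g_out.
have g2_out := vanishes_outside_derive dg1 g1_out.
have g3_out := vanishes_outside_derive dg2 g2_out.
(* [K1] absorbs g'' and 4 absorbs the linearized nonlinearity: mu - 3 u^2 >= -4 because |u| <= 1. *)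
exists (K1 + 4); first by rewrite addr_ge0.
move=> f f1 f2 A B df df1 sf f_ge0 f_out.
have sf1 := smooth_derive df sf; have sf2 := smooth_derive df1 sf1.
have cf := smooth_continuous sf; have cf1 := smooth_continuous sf1.
have cf2 := smooth_continuous sf2.
have f1_out := vanishes_outside_derive df f_out.
have f2_out := vanishes_outside_derive df1 f1_out.
have := sol (tensor f g1) (test_function_tensor sf sg1 f_out g1_out).
rewrite /laplacian (pdx_tensor _ df) (pdx_tensor _ df1) (pdy_tensor _ dg1).
rewrite (pdy_tensor _ dg2).
(* The discontinuous [mu] is isolated as a factor depending on x only: [Phi] is then measurable on
   the plane and continuous on each slice in y. *)
pose F1 p := u p * (tensor f2 g1 p + tensor f g3 p - c * tensor f1 g1 p)
  - u p ^+ 3 * tensor f g1 p.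
pose F2 p := u p * tensor f g1 p.
pose Phi p := F1 p + mu p.1 * F2 p.
have -> : (fun p : T * T =>
    u p * (tensor f2 g1 p + tensor f g3 p - c * tensor f1 g1 p) +
    (mu p.1 * u p - u p ^+ 3) * tensor f g1 p) = Phi.
  by apply/funext => p; rewrite /Phi /F1 /F2; ring.
have cF2 : continuous F2.
  by move=> p; apply: cvgM; [exact: cu | exact: continuous_tensor].
have cu3 : continuous (fun p => u p ^+ 3).
  move=> p; apply: (@continuous_comp _ _ _ u (fun x => x ^+ 3)); first exact: cu.
  exact: exprn_continuous.
have cF1 : continuous F1.
  move=> p; apply: cvgB; last first.
    by apply: cvgM; [exact: cu3 | exact: continuous_tensor].
  apply: cvgM; first exact: cu.
  apply: cvgB; first by apply: cvgD; exact: continuous_tensor.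
  by apply: cvgM; [exact: cvg_cst | exact: continuous_tensor].
have F_out x y : x < A \/ B < x \/ y < a \/ b < y -> F1 (x, y) = 0 /\ F2 (x, y) = 0.
  rewrite /F1 /F2 /tensor /= => h.
  have [hx|hy] : (x < A \/ B < x) \/ (y < a \/ b < y) by tauto.
  - by rewrite f_out// f1_out// f2_out// !mul0r !(mulr0, addr0, subr0).
  - by rewrite g1_out// g3_out// !(mulr0, addr0, subr0).
have Phi_out x y : x < A \/ B < x \/ y < a \/ b < y -> Phi (x, y) = 0.
  by move=> /F_out[h1 h2]; rewrite /Phi h1 h2 mulr0 addr0.
have [M1 HM1] := continuous_box_bounded A B a b cF1.
have [M2 HM2] := continuous_box_bounded A B a b cF2.
have Phi_le p : `|Phi p| <= `|M1| + `|M2|.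
  case: p => x y.
  have [h|h] := pselect (x < A \/ B < x \/ y < a \/ b < y).
    by rewrite Phi_out// normr0 addr_ge0.
  have [xAB yab] : x \in `[A, B] /\ y \in `[a, b].
    by rewrite !in_itv /= !leNgt; split; apply/andP; split; apply/negP; tauto.
  apply: le_trans (ler_normD _ _) _; apply: lerD.
    exact: le_trans (HM1 _ _ xAB yab) (ler_norm _).
  rewrite normrM; apply: le_trans (le_trans (HM2 _ _ xAB yab) (ler_norm _)).
  by rewrite ler_piMl// ler_norml mu_bounds.
have mPhi : measurable_fun setT (Phi : T * T -> R).
  apply: measurable_funD; first exact: continuous_measurable_fun2.
  apply: measurable_funM; last exact: continuous_measurable_fun2.
  by apply: measurableT_comp measurable_mu _; exact: measurable_fst.
have iPhi := bounded_box_integrable mPhi Phi_le Phi_out.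
have cPhi x : continuous (fun y => Phi (x, y)).
  rewrite -[fun y => _]/(fun y => F1 (x, y) + mu x * F2 (x, y)) => y.
  apply: cvgD; first exact: continuous_slice2.
  by apply: cvgM; [exact: cvg_cst | exact: continuous_slice2].
have Phi_out2 x : vanishes_outside a b (fun y => Phi (x, y)).
  by move=> y h; apply: Phi_out; tauto.
have iPhi2 x := continuous_compact_support_integrable (cPhi x) (Phi_out2 x).
(* By the equation, the right-hand side 0 of the goal is the iterated integral of [Phi]; it remains
   to compare the integrands for each x. *)
have [iPsi ->] := fubini_Rintegral iPhi iPhi2 => <-.
pose w p := - v p * g p.2.
have cw : continuous w.
  move=> p; apply: cvgM; first by apply: cvgN; exact: cv.
  by apply: (@continuous_comp _ _ _ snd g); [exact: cvg_snd | exact: cg].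
have w_out x : vanishes_outside a b (fun y => w (x, y)).
  by move=> y h; rewrite /w /= g_out// mulr0.
have cV : continuous (fun x => \int[leb]_(y in `[a, b]) (- v (x, y) * g y)).
  exact: (@continuous_slice_integral R w a b cw).
apply: le_Rintegral => //.
  apply: (@continuous_compact_support_integrable _ _ A B).
    move=> x; apply: cvgM; last exact: cV.
    apply: cvgB; [apply: cvgB|]; last 2 first.
    + by apply: cvgM; [exact: cvg_cst | exact: cf1].
    + by apply: cvgM; [exact: cvg_cst | exact: cf].
    + exact: cf2.
  by move=> x h; rewrite f_out// f1_out// f2_out// !mulr0 !subr0 mul0r.
move=> x _; set L := f2 x - c * f1 x - (K1 + 4) * f x.
have iw := continuous_compact_support_integrable
  (continuous_slice2 (x := x) cw) (w_out x).
rewrite -(Rintegral_compact_support (w_out x)) -RintegralZl//.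
(* [G] collects the boundary terms of the integration by parts in [y]. *)
pose h y := u (x, y).
have dh (y : R) : is_derive y 1 h (v (x, y)) := dv x y.
pose G y := (f2 x - c * f1 x) * (h y * g y) +
  f x * (h y * g2 y + (mu x * h y - h y * h y * h y) * g y).
pose G' y := Phi (x, y) + v (x, y) *
  ((f2 x - c * f1 x) * g y + f x * (g2 y + (mu x - 3 * h y ^+ 2) * g y)).
have dG (y : R) : is_derive y 1 G (G' y).
  have d1 := is_derive_mul (is_derive_cst (f2 x - c * f1 x) y 1)
    (is_derive_mul (dh y) (dg y)).
  have d3 := is_derive_mul (is_derive_mul (dh y) (dh y)) (dh y).
  have d4 := is_derive_mul (is_derive_cst (mu x) y 1) (dh y).
  have d5 := is_derive_mul (is_deriveB d4 d3) (dg y).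
  have d6 := is_deriveD (is_derive_mul (dh y) (dg2 y)) d5.
  have d7 := is_derive_mul (is_derive_cst (f x) y 1) d6.
  have := is_deriveD d1 d7; move/is_derive_eq; apply.
  rewrite /G' /Phi /F1 /F2 /tensor /= -/(h y) !fctE; ring.
have cvx : continuous (fun y => v (x, y)) by exact: continuous_slice2.
have ch : continuous h by exact: continuous_slice2.
have cG' : continuous G'.
  move=> y; apply: cvgD; first exact: cPhi.
  apply: cvgM; first exact: cvx.
  apply: cvgD; first by apply: cvgM; [exact: cvg_cst | exact: cg].
  apply: cvgM; first exact: cvg_cst.
  apply: cvgD; first exact: cg2.
  apply: cvgM; last exact: cg.
  apply: cvgB; first exact: cvg_cst.
  apply: cvgM; first exact: cvg_cst.
  apply: (@continuous_comp _ _ _ h (fun x => x ^+ 2)); first exact: ch.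
  exact: exprn_continuous.
have G'_out : vanishes_outside a b G'.
  by move=> y hy; rewrite /G' Phi_out2// g_out// g2_out// !(mulr0, addr0).
(* Each term of [G] contains [g] or g'', which vanish at [a] and [b]. *)
have intG' : \int[leb]_y G' y = 0.
  rewrite (Rintegral_derive ab dG cG' G'_out) /G /g /g2 /bumpR.
  rewrite !flat2_out ?bumpR''_out; try by [left | right].
  by rewrite !(mulr0, addr0) subrr.
have iG' := continuous_compact_support_integrable cG' G'_out.
rewrite -[leRHS]subr0 -intG' -RintegralB//.
apply: le_Rintegral => //.
- have -> : EFin \o (fun y => L * w (x, y)) =
      (fun y => L%:E * (EFin \o (fun y => w (x, y))) y)%E.
    by apply/funext => y; rewrite /= EFinM.
  exact: integrableZl.
- have -> : EFin \o (fun y => Phi (x, y) - G' y) =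
      ((EFin \o (fun y => Phi (x, y))) \- (EFin \o G'))%E.
    by apply/funext => y; rewrite /= EFinB.
  exact: integrableB.
- move=> y _; rewrite /G' /w /L /=.
  have v0 : 0 <= - v (x, y) by rewrite oppr_ge0.
  have hy : h y ^+ 2 <= 1.
    by have := u_le1 (x, y); rewrite -/(h y) ler_norml expr2 => /andP[]; nra.
  have [m1 m2] := andP (mu_bounds x).
  have g0 : 0 <= g y := bump_ge0 _ _ _.
  (* The difference of the two sides, (Phi - G') - L w, is - v f times this expression. *)
  have key : 0 <= g2 y + (mu x - 3 * h y ^+ 2) * g y + (K1 + 4) * g y.
    have := g2ge y; set X := h y ^+ 2 in hy *; nra.
  rewrite -subr_ge0; apply: le_trans (mulr_ge0 v0 (mulr_ge0 (f_ge0 x) key)) _.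
  by rewrite le_eqVlt; apply/orP; left; apply/eqP; ring.
Qed.

Lemma tanh_lt (x y : R) : x < y -> tanh x < tanh y.
Proof.
move=> xy; rewrite /tanh.
have ex := expR_gt0 x; have ey := expR_gt0 y.
have enx := expR_gt0 (- x); have eny := expR_gt0 (- y).
rewrite ltr_pdivrMr ?addr_gt0// mulrAC ltr_pdivlMr ?addr_gt0//.
have h1 : expR x < expR y by rewrite ltr_expR.
have h2 : expR (- y) < expR (- x) by rewrite ltr_expR ltrN2.
have h3 : expR x * expR (- y) < expR y * expR (- x) by rewrite ltr_pM// ltW.
by lra.
Qed.

End Pattern.

(** * Strict monotonicity of the pattern *)

Unset Implicit Arguments.

Theorem corollary4p4 (R : realType) (c : R) (hc : 0 <= c < 2)
    (theta : R -> R) (htheta : is_theta c theta)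
    (Xi : R * R -> R) (hXi : is_Hinfty_pattern c theta Xi) :
  forall x : R,
    {homo (fun y : R => Xi (x, y)) : y1 y2 / y1 < y2 >-> y1 < y2} \/
    {homo (fun y : R => Xi (x, y)) : y1 y2 / y1 < y2 >-> y2 < y1}.
Proof.
move=> x0; right => a b ab /=.
have [C1 _ _] : C1alpha 0 Xi by apply: (Xi_C1alpha hXi); rewrite lexx ltr01.
have [cXi dXi _ cv] := C1.
have v_le0 := Xi_pdy_le0 hXi.
have dNXi (x y : R) : is_derive y 1 (fun y => - Xi (x, y)) (- pdy Xi (x, y)).
  apply: (@is_deriveN _ _ _ (fun y => Xi (x, y))).
  apply/(is_derive_sndP Xi (x, y)); apply: DeriveDef => //.
  by case: (dXi (x, y)).
have Nv_ge0 x y : 0 <= - pdy Xi (x, y) by rewrite oppr_ge0.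
have mono x y1 y2 : y1 <= y2 -> Xi (x, y2) <= Xi (x, y1).
  by move=> y12; rewrite -lerN2 (is_derive_ndecr (dNXi x) (Nv_ge0 x)).
(* By monotonicity in y the values lie between the limits - theta(x) and theta(x), and theta < 1. *)
have Xi_le1 p : `|Xi p| <= 1.
  case: p => x y; have /andP[_ /ltW t1] := theta_range htheta x.
  have Hp : Xi (x, z) @[z --> +oo] --> - theta x by exact: Xi_y_pinfty hXi _.
  have Hn : Xi (x, z) @[z --> -oo] --> theta x by exact: Xi_y_ninfty hXi _.
  rewrite ler_norml; apply/andP; split.
  - apply: (@le_trans _ _ (- theta x)); first by rewrite lerN2.
    apply: (cvgr_to_le Hp); near=> z; apply: mono.
    by near: z; exact: nbhs_pinfty_ge (num_real _).
  - apply: le_trans t1; apply: (cvgr_to_ge Hn); near=> z; apply: mono.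
    by near: z; exact: nbhs_ninfty_le (num_real _).
rewrite lt_neqAle mono ?(ltW ab)// andbT; apply/eqP => Xi_ab.
have [K K0 sV] := supersolution_of_pattern ab C1 (Xi_solution hXi) v_le0 Xi_le1.
set V := (fun x => _) in sV.
have cw : continuous (fun p => - pdy Xi p * bumpR a b p.2).
  move=> p; apply: cvgM; first by apply: cvgN; exact: cv.
  apply: (@continuous_comp _ _ _ snd (bumpR a b)); first exact: cvg_snd.
  exact: smooth_continuous (smooth_bump a b) _.
have w_ge0 x y : 0 <= - pdy Xi (x, y) * bumpR a b y by rewrite mulr_ge0// bump_ge0.
have w_out x : vanishes_outside a b (fun y => - pdy Xi (x, y) * bumpR a b y).
  by move=> y [h|h]; rewrite /bumpR flat2_out ?mulr0//; [left|right]; exact: ltW.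
(* Off (a, b) the bump vanishes; on it the y-derivative does, the end values being equal. *)
have V0 : V x0 = 0.
  rewrite /V -(Rintegral_compact_support (w_out x0)).
  rewrite -[RHS](Rintegral_set0 (@lebesgue_measure R) (fun=> 0)).
  rewrite Rintegral_mkcond [RHS]Rintegral_mkcond; congr Rintegral.
  apply/funext => y; rewrite !patchE in_set0 in_setT.
  have [->|/bump_neq0 yab] := eqVneq (bumpR a b y) 0; first by rewrite mulr0.
  have Eab : - Xi (x0, a) = - Xi (x0, b) by rewrite Xi_ab.
  by rewrite (is_derive_eq_ends (dNXi x0) (Nv_ge0 x0) Eab yab) mul0r.
(* The primitive of the nonnegative integrand has equal end values, so the integrand is 0 on (a, b).
   The bump is positive there, hence the y-derivative vanishes and the mean value theorem
   applies. *)
have V_eq0 x : V x = 0 -> Xi (x, a) = Xi (x, b).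
  move=> Vx; have cwx := continuous_slice2 (x := x) cw.
  have [S [dS _ _]] := compact_support_primitive ab cwx (w_out x).
  move: Vx; rewrite /V -(Rintegral_compact_support (w_out x)).
  rewrite (Rintegral_derive ab dS cwx (w_out x)) => /eqP.
  rewrite subr_eq0 => /eqP/esym Sab.
  have w0 := is_derive_eq_ends dS (w_ge0 x) Sab.
  have cN := is_derive_continuous (dNXi x).
  have [z] := @MVT _ _ _ a b ab (fun z _ => dNXi x z) (continuous_subspaceT cN).
  rewrite in_itv /= => zab.
  have : - pdy Xi (x, z) = 0.
    have /eqP := w0 z zab; rewrite mulf_eq0 (gt_eqF (bump_gt0 zab)) orbF.
    by move/eqP.
  by move=> -> /eqP; rewrite mul0r subr_eq0 eqr_opp => /eqP.
have Xi_left x : x < x0 -> Xi (x, a) = Xi (x, b).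
  move=> xx0; apply: V_eq0.
  apply: (@strong_minimum_principle _ c K V x0 x) => //.
  - by case/andP: hc.
  - exact: (@continuous_slice_integral R _ a b cw).
  - by move=> z; apply: Rintegral_ge0.
have ab' : a / Num.sqrt 2 < b / Num.sqrt 2.
  by rewrite ltr_pM2r// invr_gt0 sqrtr_gt0.
(* The two profiles at [a] and [b] agree for x < x0, hence so do their limits at -oo. *)
have := tanh_lt ab'; apply/negP; rewrite -leNgt -lerN2.
have La : Xi (x, a) @[x --> -oo] --> - tanh (a / Num.sqrt 2).
  exact: Xi_x_ninfty hXi _.
have Lb : Xi (x, b) @[x --> -oo] --> - tanh (b / Num.sqrt 2).
  exact: Xi_x_ninfty hXi _.
suff -> : - tanh (a / Num.sqrt 2) = - tanh (b / Num.sqrt 2) by [].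
apply: (cvg_unique (@Rhausdorff R) La).
apply: cvg_trans Lb; apply: near_eq_cvg; near=> x.
apply/esym/Xi_left; near: x; exact: nbhs_ninfty_lt (num_real _).
Unshelve. all: by end_near. Qed.
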